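(* For $n\ge0$, $$h_{n+1}(x,y;q)=(x-yq^n)h_n(x,y;q)-q^{n-1}(1-q^n)h_{n-1}(x,y;q)+yq^{n-2}(1-q^n)(1-q^{n-1})h_{n-2}(x,y;q).$$
   Context: $q$ is a fixed number with $0<|q|<1$; $(z;p)_\infty=\prod_{i\ge0}(1-zp^i)$, $(z)_\infty=(z;q)_\infty$, $(q;q)_n=\prod_{i=1}^n(1-q^i)$. The discrete big $q$-Hermite I polynomials $h_n(x,y;q)$ are defined by the formal power series identity in $t$ $$\sum_{n=0}^\infty h_n(x,y;q)\frac{t^n}{(q;q)_n}=\frac{(t^2;q^2)_\infty(yt)_\infty}{(xt)_\infty},$$ and $h_i(x,y;q)=0$ for $i<0$. *)

(* Defs.v *)
From HB Require Import structures.
From mathcomp Require Import all_boot all_order all_algebra.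
From mathcomp Require Import boolp classical_sets reals.
From mathcomp Require Import topology normedtype sequences.
From mathcomp Require Import complex ring.

Set Implicit Arguments.
Unset Strict Implicit.
Unset Printing Implicit Defensive.

Import Order.TTheory GRing.Theory Num.Theory.
Import numFieldNormedType.Exports.

Local Open Scope classical_set_scope.
Local Open Scope ring_scope.

(* A formal power series in t is its sequence of coefficients: a n = [t^n] a. *)
Definition fps (K : Type) := nat -> K.

Definition fps_one (K : fieldType) : fps K := fun n => (n == 0)%:R.

Definition fps_mul (K : fieldType) (a b : fps K) : fps K :=
  fun n => \sum_(i < n.+1) a i * b (n - i)%N.

(* The first n coefficients of 1 / a, obtained by solving
   \sum_(i <= m) b_i a_(m - i) = (m == 0) for b_m. *)
Fixpoint fps_inv_prefix (K : fieldType) (a : fps K) (n : nat) : seq K :=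
  if n is m.+1 then
    let s := fps_inv_prefix a m in
    rcons s (((m == 0)%:R - \sum_(i < m) s`_i * a (m - i)%N) / a 0)
  else [::].

Definition fps_inv (K : fieldType) (a : fps K) : fps K :=
  fun n => (fps_inv_prefix a n.+1)`_n.

Definition fps_div (K : fieldType) (a b : fps K) : fps K :=
  fps_mul a (fps_inv b).

(* (z; p)_oo for z a polynomial in the formal variable 'X = t: the product
   \prod_(i >= 0) (1 - z p^i) is taken coefficient by coefficient, as the limit
   in K of the coefficients of the partial products. *)
Definition qpoch_inf (K : numFieldType) (z : {poly K}) (p : K) : fps K :=
  fun n => lim ((\prod_(i < N) (1 - p ^+ i *: z))`_n @[N --> \oo]).

Definition qfact (K : fieldType) (q : K) (n : nat) : K :=
  \prod_(1 <= i < n.+1) (1 - q ^+ i).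

(* (t^2; q^2)_oo (y t; q)_oo / (x t; q)_oo *)
Definition hermite_rhs (K : numFieldType) (q x y : K) : fps K :=
  fps_div (fps_mul (qpoch_inf 'X^2 (q ^+ 2)) (qpoch_inf (y *: 'X) q))
          (qpoch_inf (x *: 'X) q).

(* h_n(x, y; q); lemma hermite_gf below is its defining generating function. *)
Definition hermite (K : numFieldType) (q x y : K) (n : int) : K :=
  if n is Posz m then qfact q m * hermite_rhs q x y m else 0.

Lemma size_fps_inv_prefix (K : fieldType) (a : fps K) n :
  size (fps_inv_prefix a n) = n.
Proof. by elim: n => //= n IHn; rewrite size_rcons IHn. Qed.

Lemma nth_fps_inv_prefix (K : fieldType) (a : fps K) n i :
  (i < n)%N -> (fps_inv_prefix a n)`_i = fps_inv a i.
Proof.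
elim: n => // n IHn; rewrite ltnS leq_eqVlt => /orP[/eqP-> //|ltin].
by rewrite /= nth_rcons size_fps_inv_prefix ltin IHn.
Qed.

Lemma fps_mulVf (K : fieldType) (a : fps K) :
  a 0 != 0 -> fps_mul (fps_inv a) a = fps_one K.
Proof.
move=> a0; apply/funext => n; rewrite /fps_mul /fps_one big_ord_recr /= subnn.
rewrite {2}/fps_inv /= nth_rcons size_fps_inv_prefix ltnn eqxx divfK //.
rewrite addrC -addrA [X in _ + X]addrC -sumrB big1 ?addr0 // => i _.
by rewrite nth_fps_inv_prefix ?subrr.
Qed.

Lemma qfact_neq0 (K : numFieldType) (q : K) n : `|q| < 1 -> qfact q n != 0.
Proof.
move=> q1; rewrite /qfact big_add1 /= big_mkord; apply/prodf_neq0 => i _.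
rewrite subr_eq0; apply: contraTneq q1 => /(congr1 Num.norm)/esym/eqP.
by rewrite normr1 normrX pexpr_eq1 // => /eqP->; rewrite ltxx.
Qed.

Lemma hermite_gf (K : numFieldType) (q x y : K) : `|q| < 1 ->
  (fun n : nat => hermite q x y n / qfact q n) = hermite_rhs q x y.
Proof.
by move=> q1; apply/funext => n; rewrite /= mulrAC mulfV ?mul1r ?qfact_neq0.
Qed.

Lemma qprod_coef_rec (K : numFieldType) (p c : K) N n :
  let G := \prod_(i < N) (1 - p ^+ i *: (c *: 'X)) in
  G`_n.+1 * (1 - p ^+ n.+1) = (p ^+ N - p ^+ n) * c * G`_n.
Proof.
elim: N n => [|N IHN] n /=.
  rewrite big_ord0 !coef1 /=.
  by case: n => [|n]; rewrite ?mul0r ?mulr0 // expr0 subrr !mul0r.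
rewrite big_ord_recr /=; set G := \prod_(i < N) _ in IHN *.
have coefG m : (G * (1 - p ^+ N *: (c *: 'X)))`_m =
    G`_m - (if m is m'.+1 then p ^+ N * c * G`_m' else 0).
  rewrite mulrBr mulr1 coefB -!scalerAr !coefZ coefMX.
  by case: m => [|m] /=; rewrite ?mulr0 ?mulrA.
rewrite !coefG mulrBl IHN; case: n => [|n].
  by rewrite expr0 expr1 exprS; ring.
apply/eqP; rewrite -subr_eq0; set l := (X in X == 0).
have -> : l = p ^+ N.+1 * c * ((p ^+ N - p ^+ n) * c * G`_n
                               - G`_n.+1 * (1 - p ^+ n.+1)).
  by rewrite /l !exprS; ring.
by rewrite -IHN subrr mulr0.
Qed.

Lemma qprod_coef0 (K : numFieldType) (p c : K) N :
  (\prod_(i < N) (1 - p ^+ i *: (c *: 'X)))`_0 = 1.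
Proof.
elim: N => [|N IHN]; first by rewrite big_ord0 coef1.
rewrite big_ord_recr /= mulrBr mulr1 coefB IHN -!scalerAr !coefZ coefMX /=.
by rewrite !mulr0 subr0.
Qed.

Lemma qprod_comp (K : numFieldType) (p c : K) N k n : (0 < k)%N ->
  (\prod_(i < N) (1 - p ^+ i *: (c *: 'X^k)))`_n =
  if (k %| n)%N then (\prod_(i < N) (1 - p ^+ i *: (c *: 'X)))`_(n %/ k) else 0.
Proof.
move=> k0; rewrite -coef_comp_poly_Xn // rmorph_prod /=; congr (polyseq _)`_ _.
apply: eq_bigr => i _.
by rewrite comp_polyB -[1 in RHS]/(1%:P) comp_polyC !comp_polyZ comp_polyX.
Qed.

Lemma qprod_cvg (K : numFieldType) (p c : K) n : `|p| < 1 ->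
  p ^+ N @[N --> \oo] --> (0 : K) ->
  cvg ((\prod_(i < N) (1 - p ^+ i *: (c *: 'X)))`_n @[N --> \oo]).
Proof.
move=> p1 p0; elim: n => [|n IHn].
  by under eq_fun do rewrite qprod_coef0; exact: is_cvg_cst.
have q0 : 1 - p ^+ n.+1 != 0.
  rewrite subr_eq0; apply: contraTneq p1 => /(congr1 Num.norm)/esym/eqP.
  by rewrite normr1 normrX pexpr_eq1 // => /eqP->; rewrite ltxx.
have -> : (fun N => (\prod_(i < N) (1 - p ^+ i *: (c *: 'X)))`_n.+1) =
    (fun N => (p ^+ N - p ^+ n) * c *
              (\prod_(i < N) (1 - p ^+ i *: (c *: 'X)))`_n / (1 - p ^+ n.+1)).
  by apply/funext => N; rewrite -qprod_coef_rec mulfK.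
apply: is_cvgMr_tmp; apply: is_cvgM => //; apply: is_cvgMr_tmp.
apply: is_cvgB; [exact: cvgP p0 | exact: is_cvg_cst].
Qed.

Lemma cvg_expr_complex (R : realType) (p : (R[i] : numFieldType)) : `|p| < 1 ->
  p ^+ N @[N --> \oo] --> (0 : (R[i] : numFieldType)).
Proof.
have [r r0 pr] : exists2 r : R, 0 <= r & `|p| = r%:C%C.
  by rewrite normc_def; eexists; last reflexivity; rewrite sqrtr_ge0.
rewrite pr ltcR => r1; apply/cvgr0Pnorm_lt => -[e e'].
rewrite ltcE /= => /andP[/eqP-> e0].
have := @cvg_expr R r; rewrite ger0_norm // => /(_ r1)/cvgr0Pnorm_lt/(_ e e0).
apply: filterS => N reN; have : `|p ^+ N| < e%:C%C.
  by rewrite normrX pr -rmorphXn /= ltcR; move: reN; rewrite normrX ger0_norm.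
exact.
Qed.

(* The limits defining hermite_rhs exist. *)
Lemma qpoch_inf_cvg (R : realType) (p c : (R[i] : numFieldType)) k n :
  `|p| < 1 -> (0 < k)%N ->
  cvg ((\prod_(i < N) (1 - p ^+ i *: (c *: 'X^k)))`_n @[N --> \oo]).
Proof.
move=> p1 k0; under eq_fun do rewrite qprod_comp //.
have p0 := cvg_expr_complex p1.
by case: (k %| n)%N; [exact: qprod_cvg | exact: is_cvg_cst].
Qed.

(* Main.v *)
Require Import Defs.
From mathcomp Require Import all_boot all_order all_algebra.
From mathcomp Require Import reals complex.
From HB Require Import structures.
From mathcomp Require Import boolp classical_sets topology normedtype sequences.
From mathcomp Require Import ring.

Import Order.TTheory GRing.Theory Num.Theory.
Import numFieldNormedType.Exports.
Local Open Scope ring_scope.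

(** Let F(t) be the generating function of h_n / (q;q)_n.  Splitting off the
    factor i = 0 of the infinite product (c t^k; q^k)_oo leaves the same product
    taken at q t:
      (c t^k; q^k)_oo = (1 - c t^k) (c (q t)^k; q^k)_oo
    (qpoch_inf_shift).  Applied to the three factors of F, this gives the
    q-difference equation
      (1 - x t) F(t) = (1 - t^2) (1 - y t) F(q t)
    (hermite_rhs_shift).  Its coefficient of t^(n+1) is a recurrence for
    f_n = h_n / (q;q)_n,
      (1 - q^(n+1)) f_(n+1) =
        (x - y q^n) f_n - q^(n-1) f_(n-1) + y q^(n-2) f_(n-2)
    (hermite_rhs_rec), and multiplication by (q;q)_n turns it into the claim.

    The q-difference equation is purely multiplicative, so it is derived in the
    commutative monoid of formal power series under the Cauchy product, on which
    the substitution t -> q t acts by an endomorphism. *)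

Set Implicit Arguments.
Unset Strict Implicit.
Unset Printing Implicit Defensive.

Definition fps_of_poly (K : fieldType) (p : {poly K}) : fps K := fun n => p`_n.

(** The substitution t -> q t, i.e. a(t) becomes a(q t). *)
Definition fps_dilate (K : fieldType) (q : K) (a : fps K) : fps K :=
  fun n => q ^+ n * a n.

Section FpsMonoid.
Variable K : fieldType.
Implicit Types (a b c : fps K) (p : {poly K}).

(** The coefficients of a product up to degree n only see the truncations of
    the factors at degree n, so the laws of the Cauchy product can be read off
    from those of polynomial multiplication. *)
Lemma fps_mul_coef_trunc a b m n : (m <= n)%N ->
  fps_mul a b m = ((\poly_(i < n.+1) a i) * (\poly_(i < n.+1) b i))`_m.
Proof.
move=> mn; rewrite coefM; apply: eq_bigr => i _; rewrite !coef_poly !ltnS.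
by rewrite (leq_trans (leq_subr _ _) mn) (leq_trans (leq_ord i) mn).
Qed.

Lemma fps_mulC : commutative (@fps_mul K).
Proof.
by move=> a b; apply/funext => n; rewrite !(fps_mul_coef_trunc _ _ (leqnn n)) mulrC.
Qed.

Lemma fps_mulA : associative (@fps_mul K).
Proof.
move=> a b c; apply/funext => n.
pose T a := \poly_(i < n.+1) a i : {poly K}.
transitivity ((T a * T b * T c)`_n).
  rewrite -mulrA coefM; apply: eq_bigr => i _.
  by rewrite coef_poly ltn_ord -fps_mul_coef_trunc ?leq_subr.
rewrite coefM; apply: eq_bigr => i _.
by rewrite [X in _ * X]coef_poly ltnS leq_subr -fps_mul_coef_trunc ?leq_ord.
Qed.

Lemma fps_mul1 : left_id (@fps_one K) (@fps_mul K).
Proof.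
move=> a; apply/funext => n; rewrite /fps_mul big_ord_recl /= subn0.
by rewrite /fps_one mul1r big1 ?addr0 // => i _; rewrite mul0r.
Qed.

HB.instance Definition _ := Monoid.isComLaw.Build (fps K) (@fps_one K)
  (@fps_mul K) fps_mulA fps_mulC fps_mul1.

Lemma fps_dilateM (q : K) a b :
  fps_dilate q (fps_mul a b) = fps_mul (fps_dilate q a) (fps_dilate q b).
Proof.
apply/funext => n; rewrite /fps_dilate /fps_mul mulr_sumr.
apply: eq_bigr => i _.
rewrite -{1}(subnKC (leq_ord i)) exprD; ring.
Qed.

Lemma fps_dilate1 (q : K) : fps_dilate q (@fps_one K) = @fps_one K.
Proof.
by apply/funext => -[|n]; rewrite /fps_dilate /fps_one ?mulr0 // expr0 mulr1.
Qed.

Lemma fps_mul_binomial (c : K) k a n :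
  fps_mul (fps_of_poly (1 - c *: 'X^k)) a n =
  a n - (if (k <= n)%N then c * a (n - k)%N else 0).
Proof.
rewrite /fps_mul.
under eq_bigr do rewrite /fps_of_poly coefB coef1 coefZ coefXn mulrBl.
rewrite sumrB; congr (_ - _).
  by have := congr1 (@^~ n) (fps_mul1 a).
case: leqP => kn.
  rewrite (bigD1 (Ordinal (kn : (k < n.+1)%N))) //= eqxx mulr1 big1 ?addr0 //.
  by move=> i; rewrite -val_eqE /= => /negPf ->; rewrite mulr0 mul0r.
by rewrite big1 // => i _; rewrite ltn_eqF ?mulr0 ?mul0r // (leq_ltn_trans (leq_ord i)).
Qed.

End FpsMonoid.


Lemma coef_comp_polyZX (K : comNzRingType) (p : {poly K}) (c : K) n :
  (p \Po (c *: 'X))`_n = c ^+ n * p`_n.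
Proof.
rewrite coef_comp_poly.
under eq_bigr do rewrite exprZn coefZ coefXn mulrCA.
case: (ltnP n (size p)) => np.
  rewrite (bigD1 (Ordinal np)) //= eqxx mulr1 big1 ?addr0 //.
  by move=> i; rewrite -val_eqE eq_sym /= => /negPf ->; rewrite !mulr0.
rewrite [p`_n]nth_default // mulr0 big1 // => i _.
by rewrite gtn_eqF ?mulr0 // (leq_trans (ltn_ord i)).
Qed.

(** The factor i = 0 is 1 - c t^k, and the factor i + 1 is the factor i taken at
    q t, because (q^k)^(i+1) t^k = (q^k)^i (q t)^k. *)
Lemma qprod_shift (K : comNzRingType) (q c : K) k N :
  \prod_(i < N.+1) (1 - (q ^+ k) ^+ i *: (c *: 'X^k)) =
  (1 - c *: 'X^k) *
    ((\prod_(i < N) (1 - (q ^+ k) ^+ i *: (c *: 'X^k))) \Po (q *: 'X)).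
Proof.
rewrite big_ord_recl expr0 scale1r rmorph_prod /=; congr (_ * _).
apply: eq_bigr => i _.
rewrite comp_polyB comp_polyC !comp_polyZ rmorphXn /= comp_polyX exprZn !scalerA.
by congr (1 - _ *: _); rewrite exprS; ring.
Qed.

Lemma fps_of_poly_qprodS (K : fieldType) (q c : K) k N :
  let G N := fps_of_poly (\prod_(i < N) (1 - (q ^+ k) ^+ i *: (c *: 'X^k))) in
  G N.+1 = fps_mul (fps_of_poly (1 - c *: 'X^k)) (fps_dilate q (G N)).
Proof.
apply/funext => n /=; rewrite /fps_of_poly qprod_shift coefM.
by apply: eq_bigr => i _; rewrite coef_comp_polyZX.
Qed.

(** Each coefficient of the product with 1 - c t^k involves at most two
    coefficients of the other factor, so the identity between the partial
    products with N + 1 and N factors passes to the limit. *)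
Lemma qpoch_inf_shift (K : numFieldType) (q c : K) k :
  (forall n, cvg
    ((\prod_(i < N) (1 - (q ^+ k) ^+ i *: (c *: 'X^k)))`_n @[N --> \oo])%classic) ->
  qpoch_inf (c *: 'X^k) (q ^+ k) =
  fps_mul (fps_of_poly (1 - c *: 'X^k))
          (fps_dilate q (qpoch_inf (c *: 'X^k) (q ^+ k))).
Proof.
move=> cvG; set E := qpoch_inf _ _; apply/funext => n.
pose G N := fps_of_poly (\prod_(i < N) (1 - (q ^+ k) ^+ i *: (c *: 'X^k))).
have GE m : (G N m @[N --> \oo] --> E m)%classic by exact: cvG.
have /norm_cvg_lim <- : (G N.+1 n @[N --> \oo] --> E n)%classic.
  by have := GE n; rewrite -cvg_shiftS.
apply: norm_cvg_lim.
under eq_fun do rewrite /G fps_of_poly_qprodS fps_mul_binomial -/(G _).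
rewrite fps_mul_binomial /fps_dilate.
apply: cvgB; first by apply: cvgMl_tmp; exact: GE.
by case: ifP => _; [do 2!apply: cvgMl_tmp; exact: GE | exact: cvg_cst].
Qed.

Lemma qpoch_inf0 (K : numFieldType) (p c : K) :
  qpoch_inf (c *: 'X) p 0 = 1.
Proof.
rewrite /qpoch_inf; under eq_fun do rewrite qprod_coef0.
by apply: norm_cvg_lim; exact: cvg_cst.
Qed.

(** If a(t) = l(t) a(q t) and b(t) = m(t) b(q t), then m a / b equals l times
    (a / b)(q t); the point is that m(t) / b(t) = 1 / b(q t), by uniqueness of
    inverses in a monoid. *)
Lemma fps_div_shift (K : fieldType) (q : K) (a b l m : fps K) : b 0 != 0 ->
  a = fps_mul l (fps_dilate q a) -> b = fps_mul m (fps_dilate q b) ->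
  fps_mul m (fps_div a b) = fps_mul l (fps_dilate q (fps_div a b)).
Proof.
move=> b0 aE bE; have bV := fps_mulVf b0.
have VE : fps_mul m (fps_inv b) = fps_dilate q (fps_inv b).
  have dV := congr1 (fps_dilate q) bV.
  rewrite fps_dilateM fps_dilate1 in dV.
  rewrite -[LHS]fps_mul1 -dV -fps_mulA (fps_mulA (fps_dilate q b)).
  by rewrite (fps_mulC (fps_dilate q b) m) -bE (fps_mulC b) bV fps_mulC fps_mul1.
by rewrite fps_dilateM -VE [RHS]fps_mulA -aE /fps_div fps_mulA (fps_mulC m) fps_mulA.
Qed.

(** The convergence of the products that occur in the generating function is
    the only analytic input: what follows holds over any numeric field where
    they converge. *)
Definition qpoch_inf_converges (K : numFieldType) (q : K) :=
  forall (c : K) k n, (0 < k)%N ->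
  cvg ((\prod_(i < N) (1 - (q ^+ k) ^+ i *: (c *: 'X^k)))`_n @[N --> \oo])%classic.

Lemma hermite_rhs_shift (K : numFieldType) (q x y : K) :
  qpoch_inf_converges q ->
  fps_mul (fps_of_poly (1 - x *: 'X)) (hermite_rhs q x y) =
  fps_mul (fps_of_poly (1 - 'X^2))
    (fps_mul (fps_of_poly (1 - y *: 'X)) (fps_dilate q (hermite_rhs q x y))).
Proof.
move=> cvq.
have shift c k (k0 : (0 < k)%N) := qpoch_inf_shift (fun n => cvq c k n k0).
have shift1 c := shift c 1 isT; rewrite !expr1 in shift1.
have := shift 1 2 isT; rewrite !scale1r => shift2.
rewrite fps_mulA; apply: fps_div_shift; first by rewrite qpoch_inf0 oner_eq0.
  rewrite fps_dilateM {1}shift2 {1}shift1.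
  by rewrite (Monoid.mulmACA (@fps_mul _)).
exact: shift1.
Qed.

Lemma hermite_rhs_rec (K : numFieldType) (q x y : K) n :
  let f := hermite_rhs q x y in qpoch_inf_converges q ->
  (1 - q ^+ n.+1) * f n.+1 = (x - y * q ^+ n) * f n
   - (if n is m.+1 then q ^+ m * f m else 0)
   + (if n is m.+2 then y * q ^+ m * f m else 0).
Proof.
move=> f cvq; have := congr1 (@^~ n.+1) (hermite_rhs_shift x y cvq).
rewrite -['X^2]scale1r -['X]expr1 !fps_mul_binomial -/f /fps_dilate /=.
rewrite !subSS !subn0.
(* The terms in f_(n-1) and f_(n-2), coming from t^2 and y t^3, are absent in
   low degree, which forces the distinction of n = 0, n = 1 and n >= 2. *)
case: n => [|[|m]] /=; rewrite ?subSS ?subn0 ?subnn => /eqP;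
  rewrite subr_eq => /eqP E; rewrite mulrBl mul1r {1}E; ring.
Qed.

Lemma hermite_rec (K : numFieldType) (q x y : K) (n : nat) :
  qpoch_inf_converges q ->
  hermite q x y (n%:Z + 1) =
    (x - y * q ^+ n) * hermite q x y n%:Z
    - q ^ (n%:Z - 1) * (1 - q ^+ n) * hermite q x y (n%:Z - 1)
    + y * q ^ (n%:Z - 2) * (1 - q ^+ n) * (1 - q ^ (n%:Z - 1))
      * hermite q x y (n%:Z - 2).
Proof.
move=> cvq; have rec := hermite_rhs_rec x y n cvq.
have qfactS m : qfact q m.+1 = qfact q m * (1 - q ^+ m.+1).
  by rewrite /qfact big_nat_recr.
have sub1 m : m.+1%:Z - 1 = m%:Z by rewrite -addn1 PoszD addrK.
have sub2 m : m.+2%:Z - 2 = m%:Z by rewrite -addn2 PoszD addrK.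
rewrite -PoszD addn1 [LHS]/= qfactS -mulrA rec.
(* For n = 0 and n = 1 the negative powers of q are multiplied by a vanishing
   h_(n-1) or h_(n-2), so they need no inverse of q. *)
case: n {rec} => [|[|m]].
- rewrite expr0 /=; ring.
- rewrite sub1 (_ : 1%:Z - 2 = Negz 0) //= qfactS; ring.
- rewrite sub1 sub2 /= !qfactS -!exprnP; ring.
Qed.

Theorem theorem4p3 (R : realType) (q x y : R[i]) (n : nat) :
  0 < `|q| < 1 ->
  hermite q x y (n%:Z + 1) =
    (x - y * q ^+ n) * hermite q x y n%:Z
    - q ^ (n%:Z - 1) * (1 - q ^+ n) * hermite q x y (n%:Z - 1)
    + y * q ^ (n%:Z - 2) * (1 - q ^+ n) * (1 - q ^ (n%:Z - 1))
      * hermite q x y (n%:Z - 2).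
Proof.
case/andP => _ q1; apply: hermite_rec => c k m k0.
by apply: qpoch_inf_cvg => //; rewrite normrX exprn_ilt1 // -lt0n.
Qed.
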